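(* Let $N\in\mathbb{N}$, $m\in\mathrm{Ran}[m_N]\setminus\{-1,1\}$ and $\mu\in\mathbb{R}$. Let $I\subset\Lambda$ and $f:\{-1,1\}^{|I|}\to\mathbb{R}$. Then \[ \frac{\left|\langle f\circ P_I\rangle_{\mathrm{MC}}^{m;N}-\langle f\circ P_I\rangle_{\mathrm{C}}^{\mu;N}\right|^2}{2}\le|I|\left(\max_{\phi\in\{-1,1\}^{|I|}}|f(\phi)|\right)^2\frac{\mathcal{H}(\mu_{\mathrm{MC}}^{m;N}\,\|\,\mu_{\mathrm{C}}^{\mu;N})}{N}. \]
   Context: $\Lambda$ is a finite lattice with $N=|\Lambda|$ sites, $\mathcal{S}=\{-1,1\}^\Lambda$, $M[\phi]=\sum_x\phi(x)$, $m_N=M/N$ with range $\mathrm{Ran}[m_N]$. $\mu_{\mathrm{MC}}^{m;N}$ is the uniform probability measure on $\{\phi:m_N[\phi]=m\}$; $\mu_{\mathrm{C}}^{\mu;N}$ is the probability measure on $\mathcal{S}$ with weights proportional to $e^{-\mu M[\phi]}$. $P_I$ denotes restriction of $\phi$ to the sites in $I$ (in a fixed order). Relative entropy $\mathcal{H}(\lambda_1\|\lambda_2)=\int d\lambda_1\ln\frac{d\lambda_1}{d\lambda_2}$ if $\lambda_1\ll\lambda_2$, else $+\infty$. *)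

(* Defs.v *)
From HB Require Import structures.
From mathcomp Require Import all_boot all_order all_algebra.
From mathcomp Require Import all_classical all_reals all_analysis.
Set Implicit Arguments. Unset Strict Implicit. Unset Printing Implicit Defensive.
Import Order.TTheory GRing.Theory Num.Theory.
Local Open Scope ring_scope.

Section Ising.
Variables (R : realType) (Lam : finType).

(* A configuration phi : Lam -> {-1,1}; encoded by booleans, true <-> +1. *)
Definition config := {ffun Lam -> bool}.
Definition spin (b : bool) : R := if b then 1 else -1.

Definition Mag (phi : config) : R := \sum_x spin (phi x).
Definition mN (phi : config) : R := Mag phi / #|Lam|%:R.
Definition in_range_mN (m : R) : Prop := exists phi : config, mN phi = m.

Definition muMC (m : R) (phi : config) : R :=
  if mN phi == m then (#|[set psi : config | mN psi == m]|%:R)^-1 else 0.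

Definition Zc (mu : R) : R := \sum_(psi : config) expR (- mu * Mag psi).
Definition muC (mu : R) (phi : config) : R := expR (- mu * Mag phi) / Zc mu.

Definition expect (p : config -> R) (g : config -> R) : R :=
  \sum_phi p phi * g phi.

Definition relent (p q : config -> R) : \bar R :=
  if [forall phi, (p phi != 0) ==> (q phi != 0)]
  then (\sum_(phi | p phi != 0) p phi * ln (p phi / q phi))%:E
  else +oo%E.

Definition restr (I : {set Lam}) (phi : config) : {ffun 'I_#|I| -> bool} :=
  [ffun i => phi (enum_val i)].

End Ising.
Arguments in_range_mN {R} Lam m.
Arguments muMC {R} Lam m phi.
Arguments muC {R} Lam mu phi.
Arguments restr {Lam} I phi.

(* sup norm of f : {-1,1}^n -> R (max over a nonempty finite set of
   nonnegative values, so folding with 0 is harmless) *)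
Definition supnorm (R : realType) (n : nat) (f : {ffun 'I_n -> bool} -> R) : R :=
  \big[Num.max/0]_(psi : {ffun 'I_n -> bool}) `|f psi|.

(* Main.v *)
Require Import Defs.
From HB Require Import structures.
From mathcomp Require Import all_boot all_order all_algebra all_fingroup.
From mathcomp Require Import all_classical all_reals all_analysis.
From mathcomp Require Import ring lra.
Import Order.TTheory GRing.Theory Num.Theory.
Import numFieldNormedType.Exports.
Local Open Scope ring_scope.
Set Implicit Arguments.
Unset Strict Implicit.
Unset Printing Implicit Defensive.

(* Pinsker's inequality for the marginals on I bounds half the squared difference
   of the expectations by (max |f|)^2 times the relative entropy of these
   marginals, so one needs H_I <= (|I| / N) H. The canonical measure is a product
   of identical one-site weights and the microcanonical measure is exchangeable,
   so H_S = e(S) - |S| l for every set S of sites, where e(S) is minus the Shannon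
   entropy of the microcanonical marginal on S and l does not depend on S. Adding
   the sites one by one, those of I first, exchangeability and strong
   subadditivity of the Shannon entropy make e convex in the number of sites;
   since e vanishes at the empty set, e(I) / |I| <= e(Lam) / N (Han's
   inequality). *)

(** * Pointwise bounds for the logarithm *)

Section Pointwise.
Variable R : realType.
Implicit Types a b t u : R.

(* The left-hand side is (t - 1)/t + 3 (t - 1)^2 / (2 t (t + 2)) in partial
   fractions; it is chosen so that the derivative of the difference is
   (t - 1)^3 / (t (t + 2))^2. *)
Lemma ln_lower_bound t : 0 < t ->
  5 / 2 - 4^-1 * t^-1 - 27 / 4 * (t + 2)^-1 <= ln t.
Proof.
move=> t0.
pose psi (x : R) : R := ln x + 4^-1 * x^-1 + 27 / 4 * (x + 2)^-1 - 5 / 2.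
pose dpsi (x : R) : R := x^-1 - 4^-1 * x ^- 2 - 27 / 4 * (x + 2) ^- 2.
have dpsiE (x : R) : 0 < x -> is_derive x 1 psi (dpsi x).
  move=> x0; have x2 : x + 2 != 0 by apply: lt0r_neq0; lra.
  have xn0 : x != 0 by exact: lt0r_neq0.
  have H1 := is_derive1_ln x0.
  have H2 : is_derive x 1 (fun y : R => y^-1) (- x ^- 2 *: 1).
    exact: is_deriveV.
  have H3 : is_derive x 1 (fun y : R => (y + 2)^-1) (- (x + 2) ^- 2 *: (1 + 0)).
    exact: is_deriveV.
  by apply: is_derive_eq; rewrite /dpsi /GRing.scale /=; ring.
have dpsi_cubic (x : R) : 0 < x -> dpsi x = (x - 1) ^+ 3 / (x * (x + 2)) ^+ 2.
  move=> x0; rewrite /dpsi; field.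
  by apply/andP; split; apply: lt0r_neq0; lra.
have psi_cont a b : 0 < a -> ({within `[a, b], continuous psi})%classic.
  move=> a0; apply: derivable_within_continuous => x; rewrite in_itv /= => /andP[ax _].
  by have /dpsiE[] := lt_le_trans a0 ax.
have psi1 : psi 1 = 0 by rewrite /psi ln1; field.
suff : 0 <= psi t by rewrite /psi; lra.
(* [psi 1 = 0] and [dpsi x] has the sign of [x - 1], so the mean value theorem gives [0 <= psi t] on
   either side of 1. *)
have [t1|/ltW t1] := leP 1 t.
- have [|c] := @MVT_segment R psi dpsi 1 t t1 _ (psi_cont 1 t ltr01).
    by move=> x; rewrite in_itv /= => /andP[x1 _]; apply: dpsiE; lra.
  rewrite in_itv /= => /andP[c1 _]; rewrite psi1 subr0 => ->.
  rewrite dpsi_cubic; last by lra.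
  apply: mulr_ge0; last by lra.
  apply: divr_ge0; first by apply: exprn_ge0; lra.
  by apply: exprn_ge0; apply: mulr_ge0; lra.
have [|c] := @MVT_segment R psi dpsi t 1 t1 _ (psi_cont t 1 t0).
  by move=> x; rewrite in_itv /= => /andP[x1 _]; apply: dpsiE; lra.
rewrite in_itv /= => /andP[ct c1]; rewrite psi1 sub0r => psitE.
rewrite -oppr_le0 psitE dpsi_cubic; last by lra.
apply: mulr_le0_ge0; last by lra.
apply: mulr_le0_ge0; last by rewrite invr_ge0; apply: exprn_ge0; apply: mulr_ge0; lra.
by rewrite exprS; apply: mulr_le0_ge0; [lra|exact: sqr_ge0].
Qed.

(** Optimising over [u] gives [a ln (a / b) - (a - b) >= 3 (a - b)^2 / (2 (a + 2 b))]. With [u] kept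
    free, the other terms are linear in [a] and [b], so the bound can be summed without
    Cauchy-Schwarz. *)
Lemma entropy_linear_bound a b u : 0 <= a -> 0 <= b -> (b = 0 -> a = 0) ->
  u * (a - b) <= a * ln (a / b) - (a - b) + u ^+ 2 * (a + 2 * b) / 6.
Proof.
move=> a0 b0 ab0.
have [b00|bn0] := eqVneq b 0; first by rewrite b00 (ab0 b00); lra.
have {ab0} {}b0 : 0 < b by rewrite lt_def bn0.
have [->|an0] := eqVneq a 0.
  (* Completes the square: [u^2 / 3 + u + 1 = (u + 3/2)^2 / 3 + 1/4]. *)
  have := sqr_ge0 (u + 3 / 2); move: b0; rewrite mul0r !add0r expr2; nra.
have {}a0 : 0 < a by rewrite lt_def an0.
have ab_gt0 : 0 < a + 2 * b by lra.
have H : 3 / 2 * (a - b) ^+ 2 / (a + 2 * b) <= a * ln (a / b) - (a - b).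
  have := @ln_lower_bound (a / b) (divr_gt0 a0 b0).
  rewrite -(ler_pM2l a0); set L := ln _ => le1.
  suff <- : a * (5 / 2 - 4^-1 * (a / b)^-1 - 27 / 4 * (a / b + 2)^-1)
      - (a - b) = 3 / 2 * (a - b) ^+ 2 / (a + 2 * b) by lra.
  field; rewrite !lt0r_neq0 //; lra.
apply: le_trans (lerD H (lexx _)).
rewrite -subr_ge0.
have -> : 3 / 2 * (a - b) ^+ 2 / (a + 2 * b) + u ^+ 2 * (a + 2 * b) / 6
    - u * (a - b)
  = (3 * (a - b) - u * (a + 2 * b)) ^+ 2 / (6 * (a + 2 * b)).
  by field; apply: lt0r_neq0.
by apply: divr_ge0; [exact: sqr_ge0|lra].
Qed.

End Pointwise.

(** * Pinsker's inequality on a finite set *)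

Section FinitePinsker.
Variables (R : realType) (C : finType).

(** Take [u = s * g x] in the pointwise bound and sum over [x]: the weights [(P x + 2 Q x) / 6] add
    up to 1/2. Then optimise over [s]. *)
Lemma finite_pinsker (P Q g : C -> R) (c : R) :
    (forall x, 0 <= P x) -> (forall x, 0 <= Q x) ->
    (forall x, Q x = 0 -> P x = 0) ->
    \sum_x P x = 1 -> \sum_x Q x = 1 -> (forall x, `|g x| <= c) ->
  (\sum_x P x * g x - \sum_x Q x * g x) ^+ 2 / 2
    <= c ^+ 2 * \sum_x P x * ln (P x / Q x).
Proof.
move=> P0 Q0 QP P1 Q1 gc; rewrite -sumrB.
under eq_bigr do rewrite -mulrBl.
set D := \sum_x _; set K := \sum_x _.
have c0 : 0 <= c.
  case: (pickP (@predT C)) => [x _|C0]; first exact: le_trans (gc x).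
  by move: P1; rewrite big_pred0 // => /esym/eqP; rewrite oner_eq0.
have [cz|cn0] := eqVneq c 0.
  have -> : D = 0.
    rewrite /D big1 // => x _; have := gc x.
    by rewrite cz normr_le0 => /eqP ->; rewrite mulr0.
  by rewrite cz !expr2; lra.
have c2 : 0 < c ^+ 2 by rewrite exprn_gt0 // lt_def cn0.
have bound s : s * D <= K + s ^+ 2 * c ^+ 2 / 2.
  have -> : K + s ^+ 2 * c ^+ 2 / 2
      = \sum_x (P x * ln (P x / Q x) - (P x - Q x)
       + s ^+ 2 * c ^+ 2 * (P x + 2 * Q x) / 6).
    rewrite big_split /= sumrB sumrB P1 Q1 subrr subr0 -mulr_suml -mulr_sumr.
    by rewrite big_split /= -mulr_sumr P1 Q1 /K; field.
  rewrite /D mulr_sumr; apply: ler_sum => x _.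
  have := entropy_linear_bound (s * g x) (P0 x) (Q0 x) (QP x).
  rewrite (mulrC (P x - Q x)) mulrA => /le_trans; apply.
  rewrite lerD2l ler_pM2r ?invr_gt0 // ler_wpM2r //.
    by rewrite addr_ge0 // mulr_ge0.
  rewrite exprMn ler_wpM2l ?sqr_ge0 // -real_normK ?num_real //.
  by rewrite lerXn2r ?nnegrE.
(* This [s] maximises [s D - s^2 c^2 / 2]. *)
have := bound (D / c ^+ 2); rewrite -(ler_pM2l c2) mulrDr -lerBlDr => H.
apply: le_trans H; rewrite le_eqVlt; apply/orP; left; apply/eqP.
by field.
Qed.

End FinitePinsker.

(** * Marginal laws and Shannon entropy *)

Section Pushforward.
Variables (R : realType) (W : finType) (p : W -> R).
Hypothesis p_ge0 : forall w, 0 <= p w.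
Hypothesis p_sum1 : \sum_w p w = 1.

Definition pushf (C : finType) (V : W -> C) (v : C) : R :=
  \sum_(w | V w == v) p w.

Lemma sum_pushf (C : finType) (V : W -> C) (G : C -> R) :
  \sum_w p w * G (V w) = \sum_v pushf V v * G v.
Proof.
rewrite (partition_big V predT) //=; apply: eq_bigr => v _.
by rewrite /pushf mulr_suml; apply: eq_bigr => w /eqP ->.
Qed.

Lemma pushf_sum1 (C : finType) (V : W -> C) : \sum_v pushf V v = 1.
Proof. by rewrite -p_sum1 (partition_big V predT). Qed.

Lemma pushf_ge0 (C : finType) (V : W -> C) v : 0 <= pushf V v.
Proof. exact: sumr_ge0. Qed.

Lemma le_pushf (C : finType) (V : W -> C) w : p w <= pushf V (V w).
Proof. by rewrite /pushf (bigD1 w) //= lerDl sumr_ge0. Qed.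

Lemma pushf_pair (B C : finType) (X : W -> B) (Y : W -> C) v :
  \sum_x pushf (fun w => (X w, Y w)) (x, v) = pushf Y v.
Proof.
rewrite /pushf [RHS](partition_big X predT) //=; apply: eq_bigr => x _.
by apply: eq_bigl => w; rewrite xpair_eqE andbC.
Qed.

(* The negative of the Shannon entropy of the random variable [V] under [p]. *)
Definition nent (C : finType) (V : W -> C) : R :=
  \sum_w p w * ln (pushf V (V w)).

(** Entropy depends only on the partition into level sets, so the codomain may be changed freely. *)
Lemma eq_nent (B C : finType) (V : W -> B) (V' : W -> C) :
  (forall w w', (V w == V w') = (V' w == V' w')) -> nent V = nent V'.
Proof.
move=> VV'; apply: eq_bigr => w _; congr (_ * ln _).
by apply: eq_bigl => w'; exact: VV'.
Qed.

Lemma nent_comp (C : finType) (V : W -> C) (s : W -> W) :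
  injective s -> (forall w, p (s w) = p w) -> nent (fun w => V (s w)) = nent V.
Proof.
move=> s_inj ps; rewrite /nent [RHS](reindex_inj s_inj) /=.
apply: eq_bigr => w _; rewrite ps; congr (_ * ln _).
by rewrite /pushf [RHS](reindex_inj s_inj) /=; apply: eq_bigr => w' _; rewrite ps.
Qed.

Lemma nent_const (C : finType) (v : C) : nent (fun=> v) = 0.
Proof.
rewrite /nent big1 // => w _.
by rewrite /pushf (eq_bigl predT) => [|w'] /=; rewrite ?eqxx // p_sum1 ln1 mulr0.
Qed.

(* By [ln t <= t - 1], the difference of the two sides is at most the total mass
   of the conditionally independent coupling [T] minus 1. *)
Lemma nent_submodular (A B C : finType) (X : W -> A) (Y : W -> B) (Z : W -> C) :
  nent (fun w => (X w, Z w)) + nent (fun w => (Y w, Z w))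
    <= nent (fun w => (X w, (Y w, Z w))) + nent Z.
Proof.
set XZ := fun w => (X w, Z w); set YZ := fun w => (Y w, Z w).
set XYZ := fun w => (X w, (Y w, Z w)).
pose T (v : A * (B * C)) :=
  pushf XZ (v.1, v.2.2) * pushf YZ v.2 / pushf Z v.2.2.
have T_ge0 v : 0 <= T v by rewrite /T divr_ge0 ?mulr_ge0 ?pushf_ge0.
have sumT : \sum_v T v = 1.
  rewrite -(pair_bigA _ (fun x v => T (x, v))) exchange_big /=.
  rewrite -(pushf_sum1 Z) -(pair_bigA _ (fun y z => \sum_x T (x, (y, z)))).
  rewrite exchange_big /=.
  apply: eq_bigr => z _; rewrite /T /=.
  under eq_bigr => y _ do rewrite -mulr_suml -mulr_suml.
  rewrite -mulr_suml -mulr_sumr !pushf_pair.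
  have [->|z0] := eqVneq (pushf Z z) 0; first by rewrite !mul0r.
  by rewrite mulfK.
rewrite -subr_le0 /nent -!big_split /= -sumrB.
apply: le_trans (_ : \sum_w p w * (T (XYZ w) / pushf XYZ (XYZ w) - 1) <= _).
  apply: ler_sum => w _; rewrite -!mulrDr -mulrBr.
  have [->|pw0] := eqVneq (p w) 0; first by rewrite !mul0r.
  have {}pw0 : 0 < p w by rewrite lt_def pw0 p_ge0.
  rewrite ler_pM2l //.
  have pos (D : finType) (V : W -> D) : pushf V (V w) \is Num.pos.
    by rewrite posrE (lt_le_trans pw0) ?le_pushf.
  have := pos _ XZ; have := pos _ YZ; have := pos _ XYZ; have := pos _ Z.
  rewrite /T /=; move: (pushf XZ _) (pushf YZ _) (pushf XYZ _) (pushf Z _).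
  move=> a b u z z0 u0 b0 a0.
  have abz : a * b / z / u \is Num.pos.
    by rewrite !posrE in a0 b0 u0 z0 *; rewrite !divr_gt0 ?mulr_gt0.
  have -> : ln a + ln b - (ln u + ln z) = ln (a * b / z / u).
    rewrite ln_div ?ln_div ?lnM //; rewrite ?posrE ?divr_gt0 ?mulr_gt0 //.
    by rewrite opprD addrA addrAC.
  by rewrite -[X in ln X](subrKC 1) le_ln1Dx //; rewrite posrE in abz; lra.
rewrite (sum_pushf XYZ (fun v => T v / pushf XYZ v - 1)).
apply: le_trans (_ : \sum_v (T v - pushf XYZ v) <= _); last first.
  by rewrite sumrB sumT pushf_sum1 subrr.
apply: ler_sum => v _; rewrite mulrBr mulr1 lerD2r.
(* Off the support the left side is 0 and [T_ge0] suffices; on it equality holds. *)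
have [->|v0] := eqVneq (pushf XYZ v) 0; first by rewrite mul0r.
by rewrite mulrC divfK.
Qed.

End Pushforward.

(** Convexity and [e 0 = 0] make the slope [e k / k] nondecreasing: first between neighbours, then
    by chaining. Denominators are cleared so that [k = 0] is included. *)
Lemma convex_seq_slope (R : realFieldType) (e : nat -> R) (n : nat) :
    e 0 = 0 ->
    (forall k, (k.+2 <= n)%N -> 2 * e k.+1 <= e k + e k.+2) ->
  forall k, (k <= n)%N -> n%:R * e k <= k%:R * e n.
Proof.
move=> e0 convex.
have step k : (k < n)%N -> k.+1%:R * e k <= k%:R * e k.+1.
  elim: k => [|k IH] kn; first by rewrite e0 mulr0 mul0r.
  have := IH (ltnW kn); have := ler_wpM2l (ler0n R k.+1) (convex k kn).
  rewrite -!natr1; lra.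
have slope k d : (k + d <= n)%N -> (k + d)%:R * e k <= k%:R * e (k + d)%N.
  elim: d => [|d IH] kd; first by rewrite addn0.
  rewrite addnS in kd *.
  (* The factor [k + d] is cancelled below, so it has to be nonzero there. *)
  have [kd0|kd0] := posnP (k + d).
    have -> : k = 0%N by move/eqP: kd0; rewrite addn_eq0 => /andP[/eqP].
    by rewrite e0 mulr0 mul0r.
  rewrite -(@ler_pM2l R (k + d)%:R) ?ltr0n //.
  have := ler_wpM2l (ler0n R (k + d).+1) (IH (ltnW kd)).
  have := ler_wpM2l (ler0n R k) (step _ kd).
  lra.
by move=> k kn; have := slope k (n - k)%N; rewrite subnKC //; apply.
Qed.

(** * Exchangeable laws compared with product measures *)

Section Exchangeable.
Variables (R : realType) (Lam : finType).
Local Notation conf := {ffun Lam -> bool}.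
Implicit Types (S : {set Lam}) (phi psi : conf) (x y : Lam).

(* The restriction of a configuration to [S], extended by [false] outside [S] so
   that all restrictions live in the same type. *)
Definition mask S phi : conf := [ffun x => (x \in S) && phi x].

Lemma mask_eqP S phi psi :
  reflect {in S, forall x, phi x = psi x} (mask S phi == mask S psi).
Proof.
apply: (iffP eqP) => [/ffunP eqm x xS|eqS].
  by have := eqm x; rewrite !ffunE xS.
by apply/ffunP => x; rewrite !ffunE; case: (boolP (x \in S)) => // /eqS ->.
Qed.

Lemma mask_setU1_eq S x phi psi :
  (mask (x |: S) phi == mask (x |: S) psi)
    = ((phi x, mask S phi) == (psi x, mask S psi)).
Proof.
rewrite xpair_eqE; apply/mask_eqP/andP => [eqS|[/eqP eqx /mask_eqP eqS] z].
  split; first by rewrite eqS // setU11.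
  by apply/mask_eqP => z zS; rewrite eqS // setU1r.
by rewrite finset.in_setU1 => /predU1P[->|/eqS].
Qed.

Definition swap x y phi : conf := [ffun z => phi (tperm x y z)].

Lemma swap_inj x y : injective (swap x y).
Proof. by apply: inv_inj => phi; apply/ffunP => z; rewrite !ffunE tpermK. Qed.

Section Entropy.
Variable p : conf -> R.
Hypothesis p_ge0 : forall phi, 0 <= p phi.
Hypothesis p_sum1 : \sum_phi p phi = 1.
Hypothesis p_swap : forall x y phi, p (swap x y phi) = p phi.

Lemma mean_site_const (h : bool -> R) x y :
  \sum_phi p phi * h (phi x) = \sum_phi p phi * h (phi y).
Proof.
rewrite (reindex_inj (@swap_inj x y)) /=; apply: eq_bigr => phi _.
by rewrite p_swap ffunE tpermL.
Qed.

(** All one-site marginals agree; with [h] the log of the site weight this is the term linear in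
    [#|S|] of the relative entropy. *)
Lemma mean_sites (h : bool -> R) S x0 :
  \sum_phi p phi * (\sum_(x in S) h (phi x))
    = #|S|%:R * \sum_phi p phi * h (phi x0).
Proof.
under eq_bigr do rewrite mulr_sumr.
rewrite exchange_big /= (eq_bigr (fun=> \sum_phi p phi * h (phi x0))).
  by rewrite sumr_const mulr_natl.
by move=> x _; exact: mean_site_const.
Qed.

Lemma nent_mask1 S x :
  nent p (mask (x |: S)) = nent p (fun phi => (phi x, mask S phi)).
Proof. by apply: eq_nent => phi psi; rewrite mask_setU1_eq. Qed.

(** Nested pairs are the shape that [nent_submodular] takes. *)
Lemma nent_mask2 S x y :
  nent p (mask (x |: (y |: S)))
    = nent p (fun phi => (phi x, (phi y, mask S phi))).
Proof.
apply: eq_nent => phi psi.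
by rewrite mask_setU1_eq !xpair_eqE mask_setU1_eq xpair_eqE.
Qed.

(** The transposition of [x] and [y] preserves [p] and fixes every site of [S]. *)
Lemma nent_mask_swap S x y : x \notin S -> y \notin S ->
  nent p (mask (x |: S)) = nent p (mask (y |: S)).
Proof.
move=> xS yS; rewrite !nent_mask1 -(nent_comp _ (@swap_inj x y)) //.
suff maskE phi : mask S (swap x y phi) = mask S phi.
  by apply: eq_nent => phi psi; rewrite !maskE !ffunE !tpermL.
apply/ffunP => z; rewrite !ffunE.
have [zS|//] := boolP (z \in S).
rewrite tpermD //; first by apply: contraNneq xS => ->.
by apply: contraNneq yS => ->.
Qed.

Lemma nent_mask_le I :
  #|Lam|%:R * nent p (mask I) <= #|I|%:R * nent p id.
Proof.
(* An empty [I] gives 0 on both sides; otherwise a site of [I] serves as the default of [nth]. *)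
have [->|[x0 _]] := set_0Vmem I.
  have -> : nent p (mask finset.set0) = 0.
    rewrite -(nent_const p_sum1 tt); apply: eq_nent => phi psi.
    by rewrite eqxx; apply/mask_eqP => x; rewrite inE.
  by rewrite cards0 mul0r mulr0.
pose s := enum I ++ enum (~: I).
have sE x : x \in s by rewrite mem_cat !mem_enum finset.in_setC orbN.
have s_uniq : uniq s.
  rewrite cat_uniq !enum_uniq andbT /=; apply/hasPn => x.
  by rewrite !mem_enum finset.in_setC.
have s_size : size s = #|Lam| by rewrite size_cat -!cardE cardsC.
pose S k : {set Lam} := [set x in take k s].
have SS k : (k < #|Lam|)%N -> S k.+1 = nth x0 s k |: S k.
  move=> kN; apply/setP => x; rewrite finset.in_setU1 !inE (take_nth x0) ?s_size //.
  by rewrite mem_rcons in_cons.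
have notinS k : (k < #|Lam|)%N -> nth x0 s k \notin S k.
  move=> kN; rewrite inE.
  have := take_uniq k.+1 s_uniq; rewrite (take_nth x0) ?s_size //.
  by rewrite rcons_uniq => /andP[].
pose e k := nent p (mask (S k)).
have e0 : e 0%N = 0.
  rewrite -(nent_const p_sum1 tt); apply: eq_nent => phi psi.
  by rewrite eqxx; apply/mask_eqP => x; rewrite inE take0.
have eI : e #|I| = nent p (mask I).
  congr (nent p (mask _)); apply/setP => x.
  by rewrite inE cardE take_size_cat // mem_enum.
have eN : e #|Lam| = nent p id.
  apply: eq_nent => phi psi; apply/mask_eqP/eqP => [eqS|-> //].
  by apply/ffunP => x; apply: eqS; rewrite inE -s_size take_size.
rewrite -eI -eN; apply: convex_seq_slope; rewrite ?max_card //.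
move=> k kN; have k1N := ltnW kN.
have ynotin := notinS _ kN; rewrite (SS _ k1N) finset.in_setU1 negb_or in ynotin.
have /andP[_ yS] := ynotin.
(* Two one-site extensions of [S k] have equal entropy; strong subadditivity relative to [S k]
   bounds their sum. *)
have -> : 2 * e k.+1
    = nent p (mask (nth x0 s k.+1 |: S k)) + nent p (mask (nth x0 s k |: S k)).
  by rewrite (nent_mask_swap yS (notinS _ k1N)) /e SS //; lra.
rewrite /e (SS _ kN) (SS _ k1N) nent_mask2 !nent_mask1 [leRHS]addrC.
exact: nent_submodular.
Qed.

End Entropy.

Section Product.
Variable w : bool -> R.
Hypothesis w_gt0 : forall b, 0 < w b.
Hypothesis w_sum1 : \sum_b w b = 1.

Definition prodm phi : R := \prod_x w (phi x).

Lemma prodm_gt0 phi : 0 < prodm phi.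
Proof. exact: prodr_gt0. Qed.

Lemma prodm_sum1 : \sum_phi prodm phi = 1.
Proof. by rewrite -(bigA_distr_bigA (fun _ b => w b)) /= big1. Qed.

Lemma pushf_prodm S phi :
  pushf prodm (mask S) (mask S phi) = \prod_(x in S) w (phi x).
Proof.
(* [F] moves the constraint of agreeing with [phi] on [S] into the factors, so that the sum over
   configurations factorises over sites. *)
pose F x b := if (x \in S) && (b != phi x) then 0 else w b.
have -> : pushf prodm (mask S) (mask S phi)
    = \sum_(psi : conf) \prod_x F x (psi x).
  rewrite /pushf big_mkcond; apply: eq_bigr => psi _.
  case: mask_eqP => [eqS|/mask_eqP neS].
    by apply: eq_bigr => x _; rewrite /F; case: ifP => // /andP[/eqS->]; rewrite eqxx.
  have [/existsP[x Fx]|] := boolP [exists x, (x \in S) && (psi x != phi x)].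
    by rewrite (bigD1 x) //= /F Fx mul0r.
  rewrite negb_exists => /forallP eqS; case/mask_eqP: neS => x xS.
  by have := eqS x; rewrite xS negbK => /eqP.
rewrite -(bigA_distr_bigA F) [RHS]big_mkcond /=; apply: eq_bigr => x _.
rewrite -w_sum1 !big_bool /F /=.
by case: (x \in S); case: (phi x); rewrite /= ?addr0 ?add0r.
Qed.

Lemma ln_prod_weights S phi :
  ln (\prod_(x in S) w (phi x)) = \sum_(x in S) ln (w (phi x)).
Proof.
rewrite -[RHS]expRK expR_sum; congr ln.
by apply: eq_bigr => x _; rewrite lnK // posrE.
Qed.

End Product.

Lemma local_pinsker (p : conf -> R) (w : bool -> R) (I : {set Lam})
    (g : conf -> R) (c : R) :
    (0 < #|Lam|)%N ->
    (forall phi, 0 <= p phi) -> \sum_phi p phi = 1 ->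
    (forall x y phi, p (swap x y phi) = p phi) ->
    (forall b, 0 < w b) -> \sum_b w b = 1 ->
    (forall phi, g (mask I phi) = g phi) -> (forall phi, `|g phi| <= c) ->
  (\sum_phi p phi * g phi - \sum_phi prodm w phi * g phi) ^+ 2 / 2
    <= #|I|%:R * c ^+ 2 / #|Lam|%:R
       * \sum_phi p phi * ln (p phi / prodm w phi).
Proof.
move=> N0 p0 p1 pswap w0 w1 gI gc.
have [x0 _] : exists x : Lam, true by case/card_gt0P: N0 => x _; exists x.
set q := prodm w; have q0 phi : 0 <= q phi by rewrite ltW ?prodm_gt0.
pose P := pushf p (mask I); pose Q := pushf q (mask I).
pose l := \sum_phi p phi * ln (w (phi x0)).
(* The log of the product marginal is a sum over [S] of terms with common mean [l]. This is used for
   [I] and for the whole lattice. *)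
have klE S : \sum_phi p phi * ln (pushf p (mask S) (mask S phi)
      / pushf q (mask S) (mask S phi)) = nent p (mask S) - #|S|%:R * l.
  rewrite /l -(mean_sites pswap (fun b => ln (w b))) -sumrB.
  apply: eq_bigr => phi _.
  rewrite -mulrBr; have [->|pphi] := eqVneq (p phi) 0; first by rewrite !mul0r.
  have {}pphi : 0 < p phi by rewrite lt_def pphi p0.
  rewrite pushf_prodm // ln_div ?ln_prod_weights ?posrE //.
    exact: lt_le_trans (le_pushf p0 _ _).
  exact: prodr_gt0.
(* As [q] is positive, [Q v = 0] only for [v] outside the image of [mask I]. *)
have QP v : Q v = 0 -> P v = 0.
  move=> Qv; rewrite /P /pushf big1 // => phi /eqP phiv.
  have := le_pushf q0 (mask I) phi; rewrite phiv -/Q Qv => /le_lt_trans.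
  by move=> /(_ _ (prodm_gt0 w0 phi)); rewrite ltxx.
have mean_mask (r : conf -> R) :
    \sum_phi r phi * g phi = \sum_v pushf r (mask I) v * g v.
  by rewrite -sum_pushf; apply: eq_bigr => phi _; rewrite gI.
rewrite (mean_mask p) (mean_mask q).
apply: le_trans (finite_pinsker (pushf_ge0 p0 _) (pushf_ge0 q0 _) QP
  (pushf_sum1 p1 _) (pushf_sum1 (prodm_sum1 w1) _) gc) _.
rewrite -(sum_pushf p (mask I) (fun v => ln (P v / Q v))) klE.
have -> : \sum_phi p phi * ln (p phi / q phi) = nent p id - #|Lam|%:R * l.
  have idE (r : conf -> R) phi : pushf r (mask finset.setT) (mask finset.setT phi) = r phi.
    rewrite /pushf (big_pred1 phi) // => psi.
    by apply/mask_eqP/eqP => [eqS|-> //]; apply/ffunP => x; apply: eqS; rewrite inE.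
  have -> : nent p id = nent p (mask finset.setT).
    by apply: eq_bigr => phi _; rewrite idE /pushf big_pred1_eq.
  by rewrite -finset.cardsT -klE; apply: eq_bigr => phi _; rewrite !idE.
have N0R : 0 < #|Lam|%:R :> R by rewrite ltr0n.
rewrite -(ler_pM2l N0R).
have -> : #|Lam|%:R * (#|I|%:R * c ^+ 2 / #|Lam|%:R
      * (nent p id - #|Lam|%:R * l))
  = c ^+ 2 * (#|I|%:R * nent p id - #|Lam|%:R * #|I|%:R * l).
  by field; exact: lt0r_neq0.
rewrite mulrCA; apply: ler_wpM2l; first exact: sqr_ge0.
(* The terms in [l] cancel, which leaves Han's inequality. *)
by rewrite mulrBr mulrA lerD2r; exact: nent_mask_le.
Qed.

End Exchangeable.

(** * The microcanonical and canonical ensembles *)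

Section Ensembles.
Variables (R : realType) (Lam : finType).

Lemma Mag_swap x y (phi : {ffun Lam -> bool}) : Mag R (swap x y phi) = Mag R phi.
Proof.
rewrite /Mag [RHS](reindex_inj (@perm_inj _ (tperm x y))) /=.
by apply: eq_bigr => z _; rewrite ffunE.
Qed.

Lemma muMC_swap (m : R) x y phi : muMC Lam m (swap x y phi) = muMC Lam m phi.
Proof. by rewrite /muMC /mN Mag_swap. Qed.

Lemma muMC_ge0 (m : R) phi : 0 <= muMC Lam m phi.
Proof. by rewrite /muMC; case: ifP. Qed.

Lemma muMC_sum1 (m : R) : in_range_mN Lam m -> \sum_phi muMC Lam m phi = 1.
Proof.
case=> phi phim; rewrite -big_mkcond /= sumr_const.
(* The level set contains [phi], so its cardinality is invertible. *)
rewrite -[LHS]mulr_natr cardsE mulVf // pnatr_eq0 -lt0n.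
by apply/card_gt0P; exists phi; apply/eqP.
Qed.

Definition site_weight (mu : R) (b : bool) : R :=
  expR (- mu * spin R b) / \sum_b expR (- mu * spin R b).

Lemma site_partition_gt0 (mu : R) : 0 < \sum_b expR (- mu * spin R b).
Proof. by rewrite big_bool addr_gt0 ?expR_gt0. Qed.

Lemma site_weight_gt0 (mu : R) b : 0 < site_weight mu b.
Proof. by rewrite divr_gt0 ?expR_gt0 ?site_partition_gt0. Qed.

Lemma site_weight_sum1 (mu : R) : \sum_b site_weight mu b = 1.
Proof. by rewrite -mulr_suml divff // lt0r_neq0 ?site_partition_gt0. Qed.

(** The magnetisation is additive, so its exponential factors over sites; by distributivity so does
    the partition function. *)
Lemma muC_prodm (mu : R) phi : muC Lam mu phi = prodm (site_weight mu) phi.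
Proof.
rewrite /muC /prodm /site_weight prodf_div /Zc /Mag mulr_sumr expR_sum.
congr (_ / _); rewrite bigA_distr_bigA /=.
by apply: eq_bigr => psi _; rewrite mulr_sumr expR_sum.
Qed.

Lemma relentE (p q : config Lam -> R) : (forall phi, q phi != 0) ->
  relent p q = (\sum_phi p phi * ln (p phi / q phi))%:E.
Proof.
move=> q0; rewrite /relent ifT; last by apply/forallP => phi; rewrite q0 implybT.
congr (_%:E); rewrite big_mkcond; apply: eq_bigr => phi _.
by case: eqP => //= ->; rewrite mul0r.
Qed.

(** Makes [f (restr I phi)] invariant under masking, as [local_pinsker] requires. *)
Lemma restr_mask (I : {set Lam}) phi : restr I (mask I phi) = restr I phi.
Proof. by apply/ffunP => i; rewrite !ffunE enum_valP. Qed.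

End Ensembles.

Theorem theorem3p8 (R : realType) (Lam : finType) (hN : (0 < #|Lam|)%N)
  (m : R) (hm : in_range_mN Lam m) (hm1 : m != 1) (hm2 : m != -1)
  (mu : R) (I : {set Lam}) (f : {ffun 'I_#|I| -> bool} -> R) :
  ((`|expect (muMC Lam m) (fun phi => f (restr I phi))
      - expect (muC Lam mu) (fun phi => f (restr I phi))| ^+ 2 / 2)%:E
   <= ((#|I|%:R * supnorm f ^+ 2) / #|Lam|%:R)%:E
      * relent (muMC Lam m) (muC Lam mu))%E.
Proof.
have w0 := site_weight_gt0 mu.
have -> : muC Lam mu = prodm (site_weight mu).
  by apply/funext => phi; exact: muC_prodm.
rewrite relentE => [|phi]; last by rewrite lt0r_neq0 ?prodm_gt0.
rewrite -EFinM lee_fin real_normK ?num_real //.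
apply: local_pinsker => //.
- exact: muMC_ge0.
- exact: muMC_sum1.
- exact: muMC_swap.
- exact: site_weight_sum1.
- by move=> phi; rewrite restr_mask.
- by move=> phi; exact: (le_bigmax 0 (fun v => `|f v|)).
Qed.
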